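(* Let $S$, $T$ be semigroups and let $(s,t,\alpha,\beta)$ be a matched quadruple, where $s(a,b)=(ab,\theta^S_a(b))$ is a PE solution on $S$ and $t(u,v)=(uv,\theta^T_u(v))$ is a PE solution on $T$. Then the map $s\bowtie t:(S\times T)^2\to (S\times T)^2$ defined by $$(s\bowtie t)\big((a,u),(b,v)\big)=\Big(\big(a\,\alpha_u(b),\ \beta_b(u)\,v\big),\ \big(\theta^S_a(\alpha_u(b)),\ \theta^T_{\beta_b(u)}(v)\big)\Big)$$ for all $(a,u),(b,v)\in S\times T$ is a PE solution on the matched product $S\bowtie T$.
   Context: For a set $X$, a map $s:X\times X\to X\times X$ is a (set-theoretical) solution of the pentagon equation, briefly a PE solution on $X$, if $s_{23}s_{13}s_{12}=s_{12}s_{23}$ as maps $X^3\to X^3$ (juxtaposition is composition, rightmost map applied first), where $s_{12}=s\times \mathrm{id}_X$, $s_{23}=\mathrm{id}_X\times s$, $s_{13}=(\mathrm{id}_X\times\tau)s_{12}(\mathrm{id}_X\times\tau)$ and $\tau(x,y)=(y,x)$. A PE solution on a semigroup $X$ is written $s(x,y)=(xy,\theta_x(y))$, where $xy$ is the product of the semigroup and $\theta_x:X\to X$ is a map for each $x\in X$. Matched quadruple of semigroups: let $S,T$ be semigroups and $\alpha:T\to S^S$, $\beta:S\to T^T$ maps (where $X^X$ is the set of all maps $X\to X$); write $\alpha_u=\alpha(u)$ and $\beta_a=\beta(a)$. $(S,T,\alpha,\beta)$ is a matched quadruple of semigroups if for all $a,b\in S$, $u,v\in T$: (S1) $\alpha_u(a\,\alpha_v(b))=\alpha_u(a)\,\alpha_{\beta_a(u)v}(b)$;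 (S2) $\beta_a(\beta_b(u)\,v)=\beta_{b\alpha_v(a)}(u)\,\beta_a(v)$. In that case $S\times T$ is a semigroup under $(a,u)(b,v)=(a\,\alpha_u(b),\ \beta_b(u)\,v)$, called the matched product of $S$ and $T$ and denoted $S\bowtie T$. Matched quadruple: let $(S,T,\alpha,\beta)$ be a matched quadruple of semigroups, $s(a,b)=(ab,\theta^S_a(b))$ a PE solution on $S$ and $t(u,v)=(uv,\theta^T_u(v))$ a PE solution on $T$. Then $(s,t,\alpha,\beta)$ is a matched quadruple if for all $a,b,c\in S$ and $u,v\in T$: (M1) $\theta^S_a\alpha_u=\theta^S_{\alpha_v(a)}\,\alpha_{\beta_a(v)u}$; (M2) $\theta^S_{a\alpha_u(b)}=\alpha_{\theta^T_{\beta_b(u)}(v)}\,\theta^S_{a\alpha_u(b)}$; (M3) $\beta_{\theta^S_{a\alpha_u(b)}\alpha_{\beta_b(u)v}(c)}\big(\theta^T_{\beta_b(u)}(v)\big)=\theta^T_{\beta_{b\alpha_v(c)}(u)}\big(\beta_c(v)\big)$. *)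

(* Defs.v *)
From HB Require Import structures.
From mathcomp Require Import all_boot.

Set Implicit Arguments.
Unset Strict Implicit.
Unset Printing Implicit Defensive.

Local Open Scope group_scope.

(* Semigroups are magmas with an associative product, rather than instances of
   [semigroupType]: the latter also requires a [choiceType] carrier.  A
   [semigroupType] is a magma satisfying this predicate by [mulgA]. *)
Definition is_semigroup (X : magmaType) : Prop := associative (@mul X).

Section Pentagon.

Variable X : Type.
Implicit Type s : X * X -> X * X.

Definition flip (p : X * X) : X * X := (p.2, p.1).

(* [X * X * X] is [(X * X) * X], so [s x id] acts on [t.1] directly while
   [id x s] has to reassociate. *)
Definition act12 s (t : X * X * X) : X * X * X := (s t.1, t.2).

Definition act23 s (t : X * X * X) : X * X * X :=
  let: (x, y, z) := t in let: (y', z') := s (y, z) in (x, y', z').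

Definition act13 s : X * X * X -> X * X * X :=
  act23 flip \o act12 s \o act23 flip.

Definition PE_solution s : Prop :=
  act23 s \o act13 s \o act12 s =1 act12 s \o act23 s.

End Pentagon.

Definition PE_map (X : magmaType) (theta : X -> X -> X) (p : X * X) : X * X :=
  (p.1 * p.2, theta p.1 p.2).

Definition PE_solution_on (X : magmaType) (s : X * X -> X * X) : Prop :=
  [/\ is_semigroup X, PE_solution s &
      exists theta : X -> X -> X, s =1 PE_map theta].

Arguments PE_solution_on : clear implicits.

Section MatchedSemigroups.

Variables (S T : magmaType) (alpha : T -> S -> S) (beta : S -> T -> T).

Record matched_semigroups : Prop := MatchedSemigroups {
  matched_semigroupl : is_semigroup S;
  matched_semigroupr : is_semigroup T;
  matched_S1 : forall (a b : S) (u v : T),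
    alpha u (a * alpha v b) = alpha u a * alpha (beta a u * v) b;
  matched_S2 : forall (a b : S) (u v : T),
    beta a (beta b u * v) = beta (b * alpha v a) u * beta a v
}.

End MatchedSemigroups.

(* The carrier is that of [S * T]; [alpha] and [beta] are phantom parameters,
   on which the product declared below depends. *)
Definition matched_product (S T : magmaType)
    (alpha : T -> S -> S) (beta : S -> T -> T) : Type := (S * T)%type.

Section MatchedQuadruple.

Variables (S T : magmaType) (alpha : T -> S -> S) (beta : S -> T -> T).

Definition matched_mul (x y : matched_product alpha beta) :
    matched_product alpha beta :=
  let: (a, u) := x in let: (b, v) := y in (a * alpha u b, beta b u * v).

HB.instance Definition _ :=
  hasMul.Build (matched_product alpha beta) matched_mul.

Variables (thetaS : S -> S -> S) (thetaT : T -> T -> T).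

Record matched_quadruple : Prop := MatchedQuadruple {
  matched_quadruple_semigroups : matched_semigroups alpha beta;
  matched_quadruplel : PE_solution_on S (PE_map thetaS);
  matched_quadrupler : PE_solution_on T (PE_map thetaT);
  matched_M1 : forall (a : S) (u v : T),
    thetaS a \o alpha u =1 thetaS (alpha v a) \o alpha (beta a v * u);
  matched_M2 : forall (a b : S) (u v : T),
    thetaS (a * alpha u b)
      =1 alpha (thetaT (beta b u) v) \o thetaS (a * alpha u b);
  matched_M3 : forall (a b c : S) (u v : T),
    beta (thetaS (a * alpha u b) (alpha (beta b u * v) c))
         (thetaT (beta b u) v)
      = thetaT (beta (b * alpha v c) u) (beta c v)
}.

Definition matched_solution
    (p : matched_product alpha beta * matched_product alpha beta) :
    matched_product alpha beta * matched_product alpha beta :=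
  let: ((a, u), (b, v)) := p in
  ((a * alpha u b, beta b u * v),
   (thetaS a (alpha u b), thetaT (beta b u) v)).

End MatchedQuadruple.

Arguments matched_solution {S T} alpha beta thetaS thetaT p.

(* Main.v *)
Require Import Defs.
From mathcomp Require Import all_boot.

(** A map [(x, y) |-> (xy, theta_x(y))] on a semigroup solves the pentagon
    equation exactly when the last two components of the equation on
    [(x, y, z)] agree ([PE_mapP]):
      - cocycle law: [theta_x(yz) = theta_x(y) theta_xy(z)];
      - cancellation law: [theta_(theta_x(y))(theta_xy(z)) = theta_y(z)].
    The map [s |><| t] has this shape for the product of the matched semigroup,
    so it suffices to check both laws for
    [theta_(a, u)(b, v) = (theta_a(alpha_u b), theta_(beta_b u)(v))], one
    component at a time.

    The left component involves the factor [alpha_(theta^T ...)] introduced by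
    the matched product; (M2) erases it, and what is left is the law for
    [theta^S], read through (S1) for the cocycle law and through (M1) for the
    cancellation law.  In the right component, (M3) and (S2) together turn the
    pair [(theta_x(y), xy)] acting on [z] into the data
    [u' = beta_(b alpha_v(c))(u)] and [v' = beta_c(v)], after which each law is
    the one for [theta^T] at [(u', v', w)]. *)

Local Open Scope group_scope.

Lemma eq_PE_solution {X : Type} {s s' : X * X -> X * X} :
  s =1 s' -> PE_solution s -> PE_solution s'.
Proof.
move=> eq_s PEs t.
have eq12 : act12 s =1 act12 s' by move=> r; rewrite /act12 eq_s.
have eq23 : act23 s =1 act23 s' by case=> [[x y] z]; rewrite /act23 eq_s.
by have := PEs t; rewrite /act13 /comp !eq12 !eq23.
Qed.

(** At [(x, y, z)] the first components of the two sides are [(xy)z] and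
    [x(yz)], which associativity identifies; the other two give the laws. *)
Lemma PE_mapP {X : magmaType} (theta : X -> X -> X) :
  is_semigroup X ->
  PE_solution (PE_map theta) <->
  (forall x y z, theta x (y * z) = theta x y * theta (x * y) z) /\
  (forall x y z, theta (theta x y) (theta (x * y) z) = theta y z).
Proof.
move=> mulA; split=> [PE | [cocycle cancellation] [[x y] z]].
  by split=> x y z; have [] := PE (x, y, z).
by rewrite /act13 /act12 /act23 /PE_map /= cocycle cancellation mulA.
Qed.

Lemma matched_mulA {S T : magmaType} {alpha : T -> S -> S}
    {beta : S -> T -> T} :
  matched_semigroups alpha beta -> is_semigroup (matched_product alpha beta).
Proof.
case=> mulSA mulTA S1 S2 [a u] [b v] [c w].
rewrite /mul /=; congr pair; first by rewrite S1 mulSA.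
by rewrite S2 mulTA.
Qed.

Theorem theorem3 (S T : magmaType) (alpha : T -> S -> S) (beta : S -> T -> T)
    (thetaS : S -> S -> S) (thetaT : T -> T -> T)
    (hST : matched_quadruple alpha beta thetaS thetaT) :
  PE_solution_on (matched_product alpha beta)
    (matched_solution alpha beta thetaS thetaT).
Proof.
have [semiST [semiS PES _] [semiT PET _] M1 M2 M3] := hST.
have [_ _ S1 S2] := semiST.
have [cocycleS cancellationS] := (PE_mapP _ semiS).1 PES.
have [cocycleT cancellationT] := (PE_mapP _ semiT).1 PET.
have semi := matched_mulA semiST.
pose theta (x y : matched_product alpha beta) : matched_product alpha beta :=
  (thetaS x.1 (alpha x.2 y.1), thetaT (beta y.1 x.2) y.2).
have solE : PE_map theta =1 matched_solution alpha beta thetaS thetaT.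
  by case=> [[a u] [b v]].
split=> //; last by exists theta => p; rewrite solE.
apply: (eq_PE_solution solE).
apply/(PE_mapP _ semi); split=> -[a u] [b v] [c w];
  rewrite /theta /mul /=; congr pair.
- by rewrite S1 cocycleS -[alpha _ (thetaS _ _)]M2.
- by rewrite cocycleT M3 S2.
- rewrite -[alpha _ (thetaS _ _)]M2 cancellationS.
  by rewrite -[thetaS _ (alpha _ _)]M1.
- by rewrite M3 S2 cancellationT.
Qed.
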